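(* Let $\varphi$ be an admissible comparison function that is unbounded, and let $W=\varphi\circ h$. For $[f]\in C^{\sharp}_{h;\varphi}(A)$ write $L(f):=\lim_{a\to\omega_A}f(a)$ (this limit exists in $\mathbb{R}$) and define $$T:\ C^{\sharp}_{h;\varphi}(A)\longrightarrow C_b(A),\qquad T([f]):=W\cdot\bigl(f-L(f)\bigr).$$ Then $T$ is a well-defined, linear, surjective isometry (for the norm $\|\cdot\|^{\sharp}_{\infty,h;\varphi}$ on $C^{\sharp}_{h;\varphi}(A)$ and the sup-norm on $C_b(A)$), and $T(\mathcal{X})=C_0(A)$ isometrically. In particular $C^{\sharp}_{h;\varphi}(A)$ and $\mathcal{X}$ are Banach spaces, and $\mathcal{X}$ is separable whenever $C_0(A)$ is, e.g. when $A$ is second countable.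
   Context: $A$ is a non-compact, locally compact, $\sigma$-compact Hausdorff space; $h:A\to[0,\infty)$ is a fixed continuous proper exhaustion function, i.e. $h$ is continuous and $h^{-1}([0,R])$ is compact for every $R<\infty$. $C(A)$ is the space of real continuous functions on $A$; $C_b(A)$ the bounded ones with the sup-norm; $C_0(A)$ those vanishing at infinity, with the sup-norm. An admissible comparison function is a function $\varphi:[0,\infty)\to[1,\infty)$ such that (A1) $\varphi$ is continuous, non-decreasing and $\varphi(0)=1$; (A2) there is $K\ge1$ with $\varphi(r+s)\le K\varphi(r)\varphi(s)$ for all $r,s\ge0$. It is unbounded if $\varphi(t)\to\infty$ as $t\to\infty$. For $f\in C(A)$, $c\in\mathbb{R}$: $\|[f]\|^{\sharp}_{\infty,h;\varphi}:=\inf_{c\in\mathbb{R}}\sup_{a\in A}W(a)|f(a)-c|\in[0,\infty]$, where $[f]$ is the class of $f$ in $C(A)/\mathbb{R}$ (modulo constants); $C^{(h)}_\varphi(f;c):=\limsup_{h(a)\to\infty}W(a)|f(a)-c|$ and $C^{(h)}_\varphi([f]):=\inf_{c\in\mathbb{R}}C^{(h)}_\varphi(f;c)$, where $\limsup_{h(a)\to\infty}$ means $\lim_{R\to\infty}\sup_{\{h>R\}}$. $C^{\sharp}_{h;\varphi}(A):=\{[f]\in C(A)/\mathbb{R}:\|[f]\|^{\sharp}_{\infty,h;\varphi}<\infty\}$ and $\mathcal{X}:=\{[f]\in C^{\sharp}_{h;\varphi}(A):C^{(h)}_\varphi([f])=0\}$ (the decay class). $\lim_{a\to\omega_A}f(a)=L$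 means: for every $\varepsilon>0$ there is $R$ such that $|f(a)-L|<\varepsilon$ whenever $h(a)>R$. *)

(* Defs.v *)
From HB Require Import structures.
From mathcomp Require Import all_boot all_order all_algebra.
From mathcomp Require Import all_classical all_reals all_analysis.

Set Implicit Arguments.
Unset Strict Implicit.
Unset Printing Implicit Defensive.

Import Order.TTheory GRing.Theory Num.Theory.
Import numFieldNormedType.Exports.

Local Open Scope classical_set_scope.
Local Open Scope ring_scope.

Definition sigma_compact (T : topologicalType) : Prop :=
  exists K : (set T)^nat, (forall n, compact (K n)) /\ \bigcup_n K n = [set: T].

Record exhaustion (R : realType) (A : topologicalType) := Exhaustion {
  exhaustion_fun :> A -> R;
  exhaustion_ge0 : forall a, 0 <= exhaustion_fun a;
  exhaustion_continuous : continuous exhaustion_fun;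
  exhaustion_proper : forall r : R, compact (exhaustion_fun @^-1` `[0, r])
}.

(* A function [0, +oo[ -> [1, +oo[ is represented by a total function on R,
   which is unconstrained on the negative reals. *)
Definition admissible (R : realType) (phi : R -> R) : Prop :=
  [/\ forall t, 0 <= t -> 1 <= phi t,
      {within `[0, +oo[, continuous phi},
      forall r s, 0 <= r -> r <= s -> phi r <= phi s,
      phi 0 = 1 &
      exists2 K : R, 1 <= K &
        forall r s, 0 <= r -> 0 <= s -> phi (r + s) <= K * phi r * phi s].

Record comparison (R : realType) := Comparison {
  comparison_fun :> R -> R;
  comparison_admissible : admissible comparison_fun
}.

Section continuous_functions.
Context {A : topologicalType} {R : realType}.
Local Notation C := (continuousType A R).

Definition ctsfun : {pred A -> R} := mem [set f : A -> R | continuous f].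

Section sub.
Context (f : A -> R) (fP : f \in ctsfun).
Definition ctsfun_Sub_subproof := @isContinuous.Build A R f (set_mem fP).
#[local] HB.instance Definition _ := ctsfun_Sub_subproof.
Definition ctsfun_Sub : C := f.
End sub.

Lemma ctsfun_rect (K : C -> Type) :
  (forall f (Pf : f \in ctsfun), K (ctsfun_Sub Pf)) -> forall u : C, K u.
Proof.
move=> Ksub [f [[Pf]]]/=.
by suff -> : Pf = set_mem (@mem_set _ [set f | continuous f] f Pf) by apply: Ksub.
Qed.

Lemma ctsfun_valP f (Pf : f \in ctsfun) : ctsfun_Sub Pf = f :> (_ -> _).
Proof. by []. Qed.

HB.instance Definition _ := isSub.Build _ _ C ctsfun_rect ctsfun_valP.

Lemma ctsfun_submod_closed : submod_closed ctsfun.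
Proof.
split; first by rewrite inE => x; exact: cvg_cst.
move=> k f g; rewrite !inE => cf cg x.
by apply: cvgD; [apply: cvgZr; exact: cf|exact: cg].
Qed.
HB.instance Definition _ :=
  GRing.isSubmodClosed.Build R (A -> R) ctsfun ctsfun_submod_closed.
HB.instance Definition _ := [SubChoice_isSubLmodule of C by <:].

End continuous_functions.

Section classes_modulo_constants.
Context {A : topologicalType} {R : realType}.
Local Notation C := (continuousType A R).

Definition constants : {pred C} :=
  mem [set f : C | exists c : R, forall a, f a = c].

Lemma constants_submod_closed : submod_closed constants.
Proof.
split; first by rewrite inE; exists 0.
move=> k f g; rewrite !inE => -[c fc] [d gd].
by exists (k * c + d) => a; rewrite -(fc a) -(gd a).
Qed.
HB.instance Definition _ :=
  GRing.isSubmodClosed.Build R C constants constants_submod_closed.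

End classes_modulo_constants.

Section quotient_module.
Context (A : topologicalType) (R : realType).
Local Notation C := (continuousType A R).
Local Open Scope quotient_scope.

Definition Cmod : Type := Quotient.quot (@constants A R).
HB.instance Definition _ := GRing.Zmodule.on Cmod.

Definition class (f : C) : Cmod := \pi_(Quotient.quot (@constants A R)) f.

Lemma classP (x : Cmod) : class (repr x) = x.
Proof. exact: reprK. Qed.

Lemma eq_classP (f g : C) :
  class f = class g <-> exists c : R, forall a, f a = g a + c.
Proof.
rewrite (rwP eqP) /class -Quotient.idealrBE inE; split=> -[c fgc]; exists c => a.
  by rewrite -(fgc a) addrC subrK.
by rewrite -[LHS]/(f a - g a) fgc addrC addKr.
Qed.

Lemma classD f g : class (f + g) = class f + class g.
Proof. by rewrite /class !piE. Qed.

Definition scale_class (k : R) (x : Cmod) : Cmod := class (k *: repr x).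

Lemma scale_classE k f : scale_class k (class f) = class (k *: f).
Proof.
have /eq_classP[c fc] := classP (class f).
by apply/eq_classP; exists (k * c) => a; rewrite -mulrDr -fc.
Qed.

Lemma scale_classA k l x :
  scale_class k (scale_class l x) = scale_class (k * l) x.
Proof. by rewrite -[x]classP !scale_classE scalerA. Qed.

Lemma scale_class1 : left_id 1 scale_class.
Proof. by move=> x; rewrite -[x]classP !scale_classE scale1r. Qed.

Lemma scale_classDr : right_distributive scale_class +%R.
Proof.
move=> k x y; rewrite -[x]classP -[y]classP !(scale_classE, =^~ classD).
by rewrite scalerDr.
Qed.

Lemma scale_classDl x : {morph scale_class^~ x : k l / k + l}.
Proof. by move=> k l; rewrite -[x]classP !scale_classE scalerDl classD. Qed.

HB.instance Definition _ := GRing.Zmodule_isLmodule.Build R Cmod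
  scale_classA scale_class1 scale_classDr scale_classDl.

Lemma classZ k f : class (k *: f) = k *: class f.
Proof. by rewrite -scale_classE. Qed.

End quotient_module.

Section seminorms.
Context {R : realType} {A : topologicalType}.
Variables (h : exhaustion R A) (phi : comparison R).
Local Open Scope ereal_scope.

Definition weight (a : A) : R := phi (h a).

Definition weighted_dev (f : A -> R) (c : R) (a : A) : \bar R :=
  (weight a * `|f a - c|)%:E.

Definition fsharp_norm (f : A -> R) : \bar R :=
  ereal_inf [set ereal_sup [set weighted_dev f c a | a in [set: A]]
            | c in [set: R]].

Definition flimsup (f : A -> R) (c : R) : \bar R :=
  lim (ereal_sup [set weighted_dev f c a | a in [set a | (r < h a)%R]]
      @[r --> +oo%R]).

Definition fdecay_const (f : A -> R) : \bar R :=
  ereal_inf [set flimsup f c | c in [set: R]].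

(* Both quantities only depend on the class modulo constants, see sharp_normE
   and decay_constE. *)
Definition sharp_norm (x : Cmod A R) : \bar R := fsharp_norm (repr x).
Definition decay_const (x : Cmod A R) : \bar R := fdecay_const (repr x).

Lemma weight_ge1 a : (1 <= weight a)%R.
Proof.
by have [phi1 _ _ _ _] := comparison_admissible phi; exact/phi1/exhaustion_ge0.
Qed.

Let weight_ge0 a : (0 <= weight a)%R.
Proof. exact: le_trans (weight_ge1 a). Qed.

Let weighted_devDc f g k c : (forall a, f a = g a + k)%R ->
  weighted_dev f c = weighted_dev g (c - k).
Proof.
by move=> fg; apply/funext => a; rewrite /weighted_dev fg opprB addrA addrAC.
Qed.

Let inf_shift (F G : R -> \bar R) k : (forall c, F c = G (c - k)%R) ->
  ereal_inf [set F c | c in [set: R]] = ereal_inf [set G c | c in [set: R]].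
Proof.
move=> FG; congr ereal_inf; apply/seteqP; split => [_ [c _ <-]|_ [c _ <-]].
  by exists (c - k)%R.
by exists (c + k)%R => //; rewrite FG addrK.
Qed.

Lemma sharp_normE (f : continuousType A R) :
  sharp_norm (class f) = fsharp_norm f.
Proof.
have /eq_classP[k fk] := classP (class f).
rewrite /sharp_norm /fsharp_norm; apply: (inf_shift (k := k)) => c.
by rewrite (weighted_devDc c fk).
Qed.

Lemma decay_constE (f : continuousType A R) :
  decay_const (class f) = fdecay_const f.
Proof.
have /eq_classP[k fk] := classP (class f).
rewrite /decay_const /fdecay_const; apply: (inf_shift (k := k)) => c.
by rewrite /flimsup (weighted_devDc c fk).
Qed.

Definition sharp_pred : {pred Cmod A R} := mem [set x | sharp_norm x < +oo].

End seminorms.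

Section sharp_space.
Context {R : realType} {A : topologicalType}.
Variables (h : exhaustion R A) (phi : comparison R).
Local Notation W := (weight h phi).

Lemma fsharp_norm_le (f : A -> R) (M : R) : (exists c, forall a, W a * `|f a - c| <= M) ->
  (fsharp_norm h phi f <= M%:E)%E.
Proof.
move=> [c fM]; apply: (@le_trans _ _ (ereal_sup
    [set weighted_dev h phi f c a | a in [set: A]])).
  by apply: ereal_inf_lbound; exists c.
by apply: ge_ereal_sup => _ [a _ <-]; rewrite lee_fin.
Qed.

Lemma fsharp_norm_lt (f : A -> R) (M : R) : (fsharp_norm h phi f < M%:E)%E ->
  exists c, forall a, W a * `|f a - c| <= M.
Proof.
move=> /ereal_inf_lt[_ [c _ <-]] /ltW supM; exists c => a.
by rewrite -lee_fin (le_trans _ supM)//; apply: ereal_sup_ubound; exists a.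
Qed.

Lemma sharp_pred_submod_closed : submod_closed (sharp_pred h phi).
Proof.
have reprP (f : continuousType A R) : class f \in sharp_pred h phi <->
    exists M, exists c, forall a, W a * `|f a - c| <= M.
  rewrite /sharp_pred inE/= sharp_normE; split=> [fo|[M /fsharp_norm_le fM]].
    have [M fM] : exists M : R, (fsharp_norm h phi f < M%:E)%E.
      case: (fsharp_norm h phi f) fo => [r _|//|_].
        by exists (r + 1); rewrite lte_fin ltrDl.
      by exists 0; rewrite ltNyr.
    by exists M; exact: fsharp_norm_lt.
  exact: le_lt_trans fM (ltry _).
split.
  have -> : 0 = class 0 :> Cmod A R by rewrite /class piE.
  by apply/reprP; exists 0, 0 => a; rewrite subrr normr0 mulr0.
move=> k x y; rewrite -[x]classP -[y]classP -classZ -classD.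
move=> /reprP[M [c fM]] /reprP[N [d gN]]; apply/reprP.
exists (`|k| * M + N), (k * c + d) => a.
have W0 : 0 <= W a by rewrite (le_trans ler01)// weight_ge1.
rewrite (_ : _ - _ = k * (repr x a - c) + (repr y a - d)); last first.
  by rewrite -[LHS]/((k * repr x a + repr y a) - _) mulrBr opprD addrACA.
rewrite (le_trans (ler_wpM2l W0 (ler_normD _ _)))// normrM mulrDr mulrCA.
by rewrite lerD// ler_wpM2l.
Qed.

End sharp_space.

Lemma image_empty_type (S T : Type) (f : S -> T) :
  (S -> False) -> [set f a | a in [set: S]] = set0.
Proof. by move=> S0; rewrite -subset0 => x [a _ _]; case: (S0 a). Qed.

Section sharp_type.
Context {R : realType} {A : topologicalType}.

Record Csharp (h : exhaustion R A) (phi : comparison R) := MkCsharp {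
  Csharp_class :> Cmod A R;
  _ : Csharp_class \in sharp_pred h phi
}.

Variables (h : exhaustion R A) (phi : comparison R).
Local Notation W := (weight h phi).
Local Notation E := (Csharp h phi).

HB.instance Definition _ := [isSub for @Csharp_class h phi].
HB.instance Definition _ := [Choice of E by <:].
HB.instance Definition _ := GRing.isSubmodClosed.Build R (Cmod A R)
  (sharp_pred h phi) (sharp_pred_submod_closed h phi).
HB.instance Definition _ := [SubChoice_isSubLmodule of E by <:].

Definition Csharp_norm (x : E) : R := fine (sharp_norm h phi x).

Let W0 a : 0 <= W a.
Proof. by rewrite (le_trans ler01)// weight_ge1. Qed.

Let nrm_lt (x : E) f M : class f = x -> Csharp_norm x < M ->
  exists c, forall a, W a * `|f a - c| <= M.
Proof.
rewrite /Csharp_norm => fx xM; apply: fsharp_norm_lt; move: xM (valP x).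
rewrite /sharp_pred inE/= -fx sharp_normE.
by case: (fsharp_norm h phi f) => [r|//|_ _]; [rewrite lte_fin|exact: ltNyr].
Qed.

Let nrm_le (x : E) f M : class f = x -> 0 <= M ->
  (exists c, forall a, W a * `|f a - c| <= M) -> Csharp_norm x <= M.
Proof.
rewrite /Csharp_norm => <- M0 /fsharp_norm_le; rewrite sharp_normE.
by case: (fsharp_norm h phi f) => [r|//|_ //]; rewrite lee_fin.
Qed.

Let nrm_ge0 (x : E) : 0 <= Csharp_norm x.
Proof.
rewrite leNgt; apply/negP => x0.
have [A0|/existsNP[a _]] := pselect (forall a : A, False).
  move: x0; rewrite /Csharp_norm /sharp_norm /fsharp_norm.
  rewrite (_ : ereal_inf _ = -oo%E) ?ltxx//; apply/eqP; rewrite -leeNy_eq.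
  apply: ereal_inf_lbound; exists 0 => //.
  by rewrite image_empty_type// ereal_sup0.
have x2 : Csharp_norm x < Csharp_norm x / 2.
  by rewrite ltr_pdivlMr// mulr_natr mulr2n gtrDl.
have [c /(_ a)] := nrm_lt (classP _) x2.
by rewrite leNgt (lt_le_trans _ (mulr_ge0 _ _))// pmulr_llt0// invr_gt0.
Qed.

Let nrmD (x y : E) : Csharp_norm (x + y) <= Csharp_norm x + Csharp_norm y.
Proof.
apply/ler_addgt0Pr => e e0; have e2 : 0 < e / 2 by rewrite divr_gt0.
have [c fc] := nrm_lt (classP x) (ltr_pwDr e2 (lexx _)).
have [d gd] := nrm_lt (classP y) (ltr_pwDr e2 (lexx _)).
apply: (@nrm_le _ (repr (x : Cmod A R) + repr (y : Cmod A R))).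
- by rewrite classD !classP.
- by rewrite !addr_ge0 ?nrm_ge0// ltW.
exists (c + d) => a; rewrite [in leRHS](splitr e) addrACA.
apply: le_trans (lerD (fc a) (gd a)); rewrite -mulrDr ler_wpM2l//.
rewrite (_ : _ - _ = (repr (x : Cmod A R) a - c) + (repr (y : Cmod A R) a - d)).
  exact: ler_normD.
by rewrite addrACA -opprD.
Qed.

Let nrmZ_le k (x : E) : Csharp_norm (k *: x) <= `|k| * Csharp_norm x.
Proof.
apply/ler_addgt0Pr => e e0.
have k1 : 0 < `|k| + 1 by rewrite ltr_wpDl.
have [c fc] := nrm_lt (classP x) (ltr_pwDr (divr_gt0 e0 k1) (lexx _)).
apply: (@nrm_le _ (k *: repr (x : Cmod A R))).
- by rewrite classZ classP.
- by rewrite addr_ge0 ?mulr_ge0 ?nrm_ge0// ltW.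
exists (k * c) => a; rewrite [X in `|X|](_ : _ = k * (repr (x : Cmod A R) a - c));
  last by rewrite mulrBr.
rewrite normrM mulrCA (le_trans (ler_wpM2l (normr_ge0 k) (fc a)))//.
rewrite mulrDr lerD2l mulrCA ger_pMr// ler_pdivrMr// mul1r lerDl.
exact: ler01.
Qed.

Let nrmZ k (x : E) : Csharp_norm (k *: x) = `|k| * Csharp_norm x.
Proof.
apply/eqP; rewrite eq_le nrmZ_le/=.
have [->|k0] := eqVneq k 0; first by rewrite normr0 mul0r nrm_ge0.
rewrite -ler_pdivlMl ?normr_gt0// -normfV.
by rewrite -{1}[x]scale1r -(mulVf k0) -scalerA nrmZ_le.
Qed.

Let nrm0_eq0 (x : E) : Csharp_norm x = 0 -> x = 0.
Proof.
move=> x0; apply: val_inj => /=; rewrite -[LHS]classP.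
have f_cst a b : repr (x : Cmod A R) a = repr (x : Cmod A R) b.
  apply/eqP; rewrite -subr_eq0 -normr_le0; apply/ler_addgt0Pr => e e0.
  have xe : Csharp_norm x < e / 2 by rewrite x0 divr_gt0.
  have [c fc] := nrm_lt (classP x) xe.
  have {}fc z : `|repr (x : Cmod A R) z - c| <= e / 2.
    by rewrite (le_trans _ (fc z))// ler_peMl// weight_ge1.
  rewrite add0r (splitr e) (le_trans _ (lerD (fc a) (fc b)))//.
  by rewrite (distrC (repr (x : Cmod A R) b) c) ler_distD.
rewrite -[RHS]classP; apply/eq_classP.
have : class (repr (0 : Cmod A R)) = class 0 by rewrite classP /class piE.
move=> /eq_classP[k zk].
have [A0|/existsNP[a _]] := pselect (forall a : A, False).
  by exists 0 => a; case: (A0 a).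
by exists (repr (x : Cmod A R) a - k) => b; rewrite zk add0r addrC subrK.
Qed.

HB.instance Definition _ := Lmodule_isNormed.Build R E nrmD nrmZ nrm0_eq0.

Lemma Csharp_normE (x : E) : `|x| = fine (sharp_norm h phi x).
Proof. by []. Qed.

Definition decay_class : set E := [set x | decay_const h phi x = 0%E].

End sharp_type.
Arguments decay_class {R A} h phi.

Section bounded_functions.
Context {R : realType} {A : topologicalType}.
Local Notation C := (continuousType A R).

Definition bounded_cts : {pred C} := mem [set f : C | bounded_fun (f : A -> R)].

Lemma bounded_cts_submod_closed : submod_closed bounded_cts.
Proof.
have bddP (f : C) : f \in bounded_cts <-> exists M, forall a, `|f a| <= M.
  rewrite inE/=; split=> [[M [_ /(_ (M + 1))]]|[M fM]].
    by rewrite ltrDl ltr01 => /(_ isT) fM; exists (M + 1) => a; exact: fM.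
  by exists M; split; rewrite ?num_real// => N /ltW MN a _; exact: le_trans MN.
split; first by apply/bddP; exists 0 => a; rewrite normr0.
move=> k f g /bddP[M fM] /bddP[N gN]; apply/bddP; exists (`|k| * M + N) => a.
rewrite -[X in `|X|]/(k * f a + g a) (le_trans (ler_normD _ _))// lerD//.
by rewrite normrM ler_wpM2l.
Qed.
HB.instance Definition _ :=
  GRing.isSubmodClosed.Build R C bounded_cts bounded_cts_submod_closed.

End bounded_functions.

Section bounded_type.
Context (A : topologicalType) (R : realType).
Local Notation C := (continuousType A R).

Record Cb := MkCb { Cb_fun :> C; _ : Cb_fun \in bounded_cts }.

HB.instance Definition _ := [isSub for Cb_fun].
HB.instance Definition _ := [Choice of Cb by <:].
HB.instance Definition _ := [SubChoice_isSubLmodule of Cb by <:].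

Definition Cb_norm (f : Cb) : R := sup [set `|f a| | a in [set: A]].

Let norm_le (f : Cb) M : 0 <= M -> (forall a, `|f a| <= M) -> Cb_norm f <= M.
Proof.
move=> M0 fM; have [A0|/existsNP[a _]] := pselect (forall a : A, False).
  by rewrite /Cb_norm image_empty_type// sup0.
by apply: ge_sup; [exists `|f a|, a|move=> _ [b _ <-]].
Qed.

Let norm_ub (f : Cb) a : `|f a| <= Cb_norm f.
Proof.
apply: ub_le_sup; last by exists a.
move: (valP f); rewrite inE => -[M [_ /(_ (M + 1))]].
rewrite ltrDl ltr01 => /(_ isT) fM; exists (M + 1) => _ [b _ <-]; exact: fM.
Qed.

Let norm_ge0 (f : Cb) : 0 <= Cb_norm f.
Proof.
have [A0|/existsNP[a _]] := pselect (forall a : A, False).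
  by rewrite /Cb_norm image_empty_type// sup0.
exact: le_trans (norm_ub f a).
Qed.

Let normD (f g : Cb) : Cb_norm (f + g) <= Cb_norm f + Cb_norm g.
Proof.
apply: norm_le => [|a]; first by rewrite addr_ge0.
by rewrite -[X in `|X|]/(f a + g a) (le_trans (ler_normD _ _))// lerD.
Qed.

Let normZ_le k (f : Cb) : Cb_norm (k *: f) <= `|k| * Cb_norm f.
Proof.
apply: norm_le => [|a]; first by rewrite mulr_ge0.
by rewrite -[X in `|X|]/(k * f a) normrM ler_wpM2l.
Qed.

Let normZ k (f : Cb) : Cb_norm (k *: f) = `|k| * Cb_norm f.
Proof.
apply/eqP; rewrite eq_le normZ_le/=.
have [->|k0] := eqVneq k 0; first by rewrite normr0 mul0r norm_ge0.
rewrite -ler_pdivlMl ?normr_gt0// -normfV.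
by rewrite -{1}[f]scale1r -(mulVf k0) -scalerA normZ_le.
Qed.

Let norm0_eq0 (f : Cb) : Cb_norm f = 0 -> f = 0.
Proof.
move=> f0; apply: val_inj; apply/continuousEP => a.
by apply/eqP; rewrite -normr_le0 -f0.
Qed.

HB.instance Definition _ := Lmodule_isNormed.Build R Cb normD normZ norm0_eq0.

Lemma Cb_normE (f : Cb) : `|f| = sup [set `|f a| | a in [set: A]].
Proof. by []. Qed.

(* Continuous functions vanishing at infinity are bounded, so C_0(A) is a
   subset of C_b(A), with the same norm. *)
Definition C0 : set Cb :=
  [set f | forall e : R, 0 < e ->
     exists2 K : set A, compact K & forall a, ~ K a -> `|f a| < e].

End bounded_type.
Arguments C0 A R : clear implicits.

(* The filter of neighborhoods of the ideal point omega_A. *)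
Definition at_infinity (R : realType) (A : topologicalType)
    (h : exhaustion R A) : set_system A :=
  filter_from [set: R] (fun r => [set a | r < h a]).

Instance at_infinity_filter (R : realType) (A : topologicalType)
  (h : exhaustion R A) : Filter (at_infinity h).
Proof.
apply: filter_from_filter; first by exists 0.
move=> r s _ _; exists (Num.max r s) => // a /=.
by rewrite gt_max => /andP[].
Qed.

Section banach_subspaces.
Context {R : realType} {V : normedModType R}.

Definition banach_subspace (S : set V) : Prop :=
  submod_closed (mem S : {pred V}) /\
  forall F : set_system V, ProperFilter F -> F S -> cauchy F ->
    exists2 x, S x & F --> x.

Definition separable_subset (S : set V) : Prop :=
  exists D : set V, [/\ countable D, D `<=` S & S `<=` closure D].

End banach_subspaces.

(* Main.v *)
(* If W |f - c| is bounded, then f tends to c at infinity, because W does.  Hence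
   the only constant that competes in the infima defining the norm and the decay
   constant of [f] is the limit L(f), so that both are read off W (f - L(f)); the
   inverse of T sends g to the class of g / W.  For a second countable A,
   separability of C_0(A) is obtained without the Stone-Weierstrass theorem: up to
   any precision a function vanishing at infinity is described by finitely many
   basic open sets and rational values, a countable amount of data. *)

Require Import Defs.
From HB Require Import structures.
From mathcomp Require Import all_boot all_order all_algebra.
From mathcomp Require Import all_classical all_reals all_analysis.
From mathcomp Require Import ring lra.

Set Implicit Arguments.
Unset Strict Implicit.
Unset Printing Implicit Defensive.

Import Order.TTheory GRing.Theory Num.Theory.
Import numFieldNormedType.Exports.

Local Open Scope classical_set_scope.
Local Open Scope ring_scope.

(** * Pulling completeness and separability back along a linear isometry *)

Section isometric_transport.
Context {R : realType} {V V' : normedModType R} (T : {linear V -> V'}).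
Context (T_isometry : forall x, `|T x| = `|x|).

Lemma isometry_inj : injective T.
Proof.
move=> x y /eqP; rewrite -subr_eq0 -raddfB -normr_eq0 T_isometry normr_eq0.
by rewrite subr_eq0 => /eqP.
Qed.

Lemma isometry_dist x y : `|T x - T y| = `|x - y|.
Proof. by rewrite -raddfB T_isometry. Qed.

(** The image under [T] of a Cauchy filter on [S] is Cauchy, so it converges to some [T x] with [x]
    in [S]; since [T] preserves distances, the original filter converges to [x]. *)
Lemma banach_subspace_isometry (S : set V) :
  banach_subspace (T @` S) -> banach_subspace S.
Proof.
move=> [[TS0 TSD] complete]; split.
  split.
    move: TS0; rewrite !inE => -[x Sx].
    by rewrite -(raddf0 T) => /isometry_inj <-.
  move=> k x y; rewrite !inE => Sx Sy.
  have := TSD k (T x) (T y); rewrite !inE -linearP => -[||z Sz /isometry_inj <-//].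
    by exists x.
  by exists y.
move=> F FF FS /cauchyP Fc.
have TFS : (T @ F) (T @` S) by apply: (@filterS _ F _ S) FS => x Sx; exists x.
have TFc : cauchy (T @ F).
  apply/cauchyP => e /Fc[x Fx]; exists (T x).
  apply: (@filterS _ F _ (ball x e)) Fx => y; rewrite -!ball_normE /= => xy.
  by rewrite isometry_dist.
have [_ [x Sx <-] Tx] := complete _ (fmap_proper_filter _ _) TFS TFc.
exists x => //; apply/fcvgrPdist_lt => e e0.
move/fcvgrPdist_lt: Tx => /(_ e e0); rewrite near_simpl.
by apply: filterS => y; rewrite isometry_dist.
Qed.

(** A countable dense part of the image is pulled back to [S]; injectivity of [T] keeps it
    countable, and preservation of distances keeps it dense. *)
Lemma separable_subset_isometry (S : set V) :
  separable_subset (T @` S) -> separable_subset S.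
Proof.
move=> [D [Dcount DS SD]]; exists (S `&` T @^-1` D); split.
- apply/countable_injP; have /countable_injP[u uinj] := Dcount.
  exists (u \o T) => x y; rewrite !inE => -[_ Dx] [_ Dy] /uinj.
  by rewrite !inE => /(_ Dx Dy)/isometry_inj.
- by move=> x [].
move=> x Sx B /nbhs_ballP[e /= e0 xB].
have [|y [Dy]] := SD (T x) _ (ball (T x) e) (nbhsx_ballx _ _ e0).
  by exists x.
have [z Sz zy] := DS _ Dy; subst y.
rewrite -ball_normE /= isometry_dist => xz.
exists z; split; first by split.
by apply: xB; rewrite -ball_normE.
Qed.

End isometric_transport.

(** * Completeness of $C_b(A)$ and $C_0(A)$ *)

Section bounded_continuous.
Context {R : realType} {A : topologicalType}.
Implicit Types f g : Cb A R.

Lemma Cb_norm_ub f a : `|f a| <= `|f|.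
Proof.
apply: ub_le_sup; last by exists a.
move: (valP f); rewrite inE => -[M [_ /(_ (M + 1))]].
rewrite ltrDl ltr01 => /(_ isT) fM; exists (M + 1) => _ [b _ <-]; exact: fM.
Qed.

Lemma Cb_norm_le f M : 0 <= M -> (forall a, `|f a| <= M) -> `|f| <= M.
Proof.
(* For empty [A] the norm is the supremum of the empty set, which is 0 by default; this case relies
   on [0 <= M]. *)
move=> M0 fM; have [A0|/existsNP[a _]] := pselect (forall a : A, False).
  by rewrite Cb_normE image_empty_type// sup0.
by rewrite Cb_normE; apply: ge_sup; [exists `|f a|, a|move=> _ [b _ <-]].
Qed.

Lemma Cb_dist_ub f g a : `|f a - g a| <= `|f - g|.
Proof. exact: (Cb_norm_ub (f - g)). Qed.

Lemma Cb_dist_le f g M : 0 <= M -> (forall a, `|f a - g a| <= M) ->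
  `|f - g| <= M.
Proof. by move=> M0 fgM; apply: Cb_norm_le => // a; exact: fgM. Qed.

Lemma Cb_of (g : A -> R) : continuous g -> (exists M, forall a, `|g a| <= M) ->
  {f : Cb A R | f = g :> (A -> R)}.
Proof.
move=> gc gM; pose c := ctsfun_Sub (mem_set gc : g \in ctsfun).
suff cb : c \in bounded_cts by exists (MkCb cb).
rewrite inE /=; have [M {}gM] := gM.
by exists M; split; rewrite ?num_real// => N /ltW MN a _; exact: le_trans MN.
Qed.

Lemma cts_dist_lt (f : Cb A R) a e : 0 < e ->
  \forall b \near a, `|f a - f b| < e.
Proof.
by move=> e0; have /cvgrPdist_lt := @cts_fun _ _ (f : continuousType A R) a; apply.
Qed.

(** The limit is built pointwise from the completeness of the reals; the Cauchy property then makes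
    the convergence uniform, so that continuity and boundedness pass to the limit. *)
Lemma Cb_complete (F : set_system (Cb A R)) :
  ProperFilter F -> cauchy F -> exists g, F --> g.
Proof.
move=> FF /cauchyP Fc.
pose ev (a : A) (f : Cb A R) : R := f a.
have evcvg a : cvg (ev a @ F).
  apply/cauchy_cvgP/cauchyP => e /Fc[f Ff]; exists (f a).
  apply: (@filterS _ F _ (ball f e)) Ff => g; rewrite -!ball_normE /=.
  by apply: le_lt_trans; exact: Cb_dist_ub.
pose g a := lim (ev a @ F).
(* The bound $|f(a)-k(a)|\le e$ holds for all [k] in the ball around [f]; letting [k] run along [F]
   turns it into a bound against [g], uniform in [a]. *)
have near_g e : 0 < e -> exists2 f, F (ball f e) & forall a, `|f a - g a| <= e.
  move=> e0; have [f Ff] := Fc _ e0; exists f => // a.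
  apply: (@cvgr_to_le _ (ev a @ F) _ _ (fun y => `|f a - y|)).
    by apply: cvg_norm; apply: cvgB; [exact: cvg_cst|exact: evcvg].
  apply: (@filterS _ F _ (ball f e)) Ff => k; rewrite -ball_normE /= => /ltW.
  by apply: le_trans; exact: Cb_dist_ub.
have gcts : continuous g.
  move=> a; apply/cvgrPdist_lt => e e0.
  have e3 : 0 < e / 3 by rewrite divr_gt0.
  have [f _ fg] := near_g _ e3.
  have := cts_dist_lt f a e3.
  apply: filterS => b fab.
  have fa := fg a; have fb := fg b.
  have := ler_distD (f a) (g a) (g b); have := ler_distD (f b) (f a) (g b).
  by rewrite (distrC (g a) (f a)); lra.
have [g' g'E] : {g' : Cb A R | g' = g :> (A -> R)}.
  apply: Cb_of => //; have [f _ fg] := near_g _ ltr01.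
  exists (1 + `|f|) => a.
  rewrite -[g a](subrK (f a)) (le_trans (ler_normD _ _))//.
  by rewrite lerD ?Cb_norm_ub// distrC.
exists g'; apply/fcvgrPdist_lt => e e0.
have e2 : 0 < e / 2 by rewrite divr_gt0.
have [f Ff fg] := near_g _ e2; apply: filterS Ff => k.
rewrite -ball_normE /= => fk; rewrite (splitr e).
rewrite -(subrKA f) (le_lt_trans (ler_normD _ _))//.
rewrite ler_ltD//; apply: Cb_dist_le; first exact: ltW.
by move=> a; rewrite g'E distrC.
Qed.

Lemma C0_submod_closed : submod_closed (mem (C0 A R) : {pred Cb A R}).
Proof.
split.
  rewrite inE => e e0; exists set0; first exact: compact0.
  by move=> a _; rewrite normr0.
move=> k f g; rewrite !inE => f0 g0 e e0.
(* Dividing by $|k|+1$ rather than $|k|$ also covers [k = 0]. *)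
have k1 : 0 < `|k| + 1 by rewrite ltr_wpDl.
have [K Kc fK] := f0 _ (divr_gt0 (divr_gt0 e0 (ltr0Sn _ 1)) k1).
have [L Lc gL] := g0 _ (divr_gt0 e0 (ltr0Sn _ 1)).
exists (K `|` L); first exact: compactU.
move=> a /not_orP[/fK fa /gL ga]; rewrite -[X in `|X|]/(k * f a + g a).
rewrite (le_lt_trans (ler_normD _ _))// (splitr e) ler_ltD// normrM.
move: fa; rewrite ltr_pdivlMr// => /ltW; apply: le_trans.
by rewrite mulrC ler_wpM2l// lerDl.
Qed.

Lemma banach_Cb : banach_subspace [set: Cb A R].
Proof.
split; first by split; [rewrite inE|move=> k f g; rewrite !inE].
by move=> F FF _ /Cb_complete[g Fg]; exists g.
Qed.

(** $C_0(A)$ is closed in $C_b(A)$: a compact set outside which a nearby [f] is below $e/2$ serves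
    the limit with bound $e$. *)
Lemma banach_C0 : banach_subspace (C0 A R).
Proof.
split; first exact: C0_submod_closed.
move=> F FF FC0 /Cb_complete[g Fg]; exists g => // e e0.
have e2 : 0 < e / 2 by rewrite divr_gt0.
move/fcvgrPdist_lt: Fg => /(_ _ e2) Fg.
have [f [/(_ _ e2)[K Kc fK] gf]] := filter_ex (filterI FC0 Fg).
exists K => // a /fK fa; rewrite -[g a](subrK (f a)) (splitr e).
rewrite (le_lt_trans (ler_normD _ _))// ltrD//.
exact: le_lt_trans (Cb_dist_ub _ _ _) gf.
Qed.

End bounded_continuous.

(** * Separability of $C_0(A)$ for second countable [A] *)

Section separability.
Context {R : realType} {A : topologicalType}.

(* A code [(m, l)] prescribes values up to [m.+1^-1] on the finitely many basic
   sets listed in [l], and smallness elsewhere; two functions with the same code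
   are thus uniformly close. *)
Definition coded (e : nat -> set A) (c : nat * seq (nat * rat)) : set (Cb A R) :=
  [set f |
    (forall p a, p \in c.2 -> e p.1 a ->
       `|f a - ratr p.2| < c.1.+1%:R^-1) /\
    forall a, (forall p, p \in c.2 -> ~ e p.1 a) -> `|f a| < c.1.+1%:R^-1].

Lemma coded_close e c f g : coded e c f -> coded e c g ->
  `|f - g| <= 2 * c.1.+1%:R^-1.
Proof.
move=> [fin fout] [gin gout]; apply: Cb_dist_le => [|a].
  by rewrite mulr_ge0// invr_ge0.
rewrite mulr_natl mulr2n.
have [[p pc epa]|none] := pselect (exists2 p, p \in c.2 & e p.1 a).
  rewrite -(subrKA (ratr p.2)) (le_trans (ler_normD _ _))// lerD//.
    exact/ltW/fin.
  by rewrite distrC; exact/ltW/gin.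
have {}none p : p \in c.2 -> ~ e p.1 a by move=> pc epa; apply: none; exists p.
by rewrite (le_trans (ler_normB _ _))// lerD// ltW// ?fout ?gout.
Qed.

(** Around each point of the compact set where [f] may be large, continuity gives a basic set on
    which [f] stays near one rational; compactness leaves finitely many such pairs. *)
Lemma coded_exists e m (f : Cb A R) :
  (forall (a : A) U, nbhs a U -> exists n, [/\ nbhs a (e n), e n a & e n `<=` U]) ->
  C0 A R f -> exists l, coded e (m, l) f.
Proof.
move=> ebase f0; set d : R := m.+1%:R^-1.
have d0 : 0 < d by rewrite invr_gt0.
have [K /compact_near_coveringP Kc fK] := f0 _ d0.
pose good (p : nat * rat) := `[< forall a, e p.1 a -> `|f a - ratr p.2| < d >].
(* Finite lists ordered by inclusion: the near-covering form of compactness, applied along this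
   filter, turns one good pair per point into one list for all of [K]. *)
pose F : set_system (seq (nat * rat)) :=
  filter_from [set: seq (nat * rat)]
    (fun l => [set l' : seq (nat * rat) | {subset l <= l'}]).
have FF : Filter F.
  apply: filter_from_filter; first by exists [::].
  move=> l l' _ _; exists (l ++ l') => // s /= ls.
  by split=> p pl; apply: ls; rewrite mem_cat pl ?orbT.
pose P (l : seq (nat * rat)) a := exists2 p, p \in l & good p /\ e p.1 a.
have [|l _ /(_ l (fun _ => id)) Kl] := Kc _ F P FF.
  move=> a Ka; have d2 : 0 < d / 2 by rewrite divr_gt0.
  have /rat_in_itvoo[q] : f a < f a + d / 2 by rewrite ltrDl.
  rewrite in_itv/= => /andP[qa aq].
  have [n [an ena en]] := ebase a _ (cts_dist_lt f a d2).
  exists (e n, [set l : seq (nat * rat) | {subset [:: (n, q)] <= l}]).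
    by split => //=; exists [:: (n, q)].
  move=> [b l] /= [enb /(_ (n, q))]; rewrite inE eqxx => /(_ isT) ql.
  exists (n, q) => //; split=> //; apply/asboolP => z /= /en /=.
  rewrite distrC => fz; rewrite -(subrKA (f a)) (le_lt_trans (ler_normD _ _))//.
  rewrite (splitr d) ltrD// distrC ger0_norm ?subr_ge0 ?(ltW qa)//.
  by rewrite ltrBlDl.
(* The list [l] may contain pairs that violate the bound; the good ones alone still cover [K]. *)
exists [seq p <- l | good p]; split=> [p a|a none] /=.
  by rewrite mem_filter => /andP[/asboolP + _]; apply.
apply: fK => Ka; have [p pl [gp epa]] := Kl a Ka.
by apply: (none p); rewrite // mem_filter gp.
Qed.

Lemma second_countable_enum : @second_countable A ->
  exists e : nat -> set A, forall (a : A) U, nbhs a U ->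
    exists n, [/\ nbhs a (e n), e n a & e n `<=` U].
Proof.
move=> [B /countable_injP[u uinj] [Bo Bb]].
(* An index that is not a value of [u] gets the empty set; at [u V], injectivity of [u] on [B]
   returns [V] itself. *)
exists (fun n => xget set0 [set V | B V /\ u V = n]) => a U /Bb[V [BV Va] VU].
exists (u V); case: xgetP => [W _ [BW /uinj]|/(_ V)[]//].
rewrite !inE => /(_ BW BV) ->; split=> //.
by apply: open_nbhs_nbhs; split=> //; exact: Bo.
Qed.

(** There are countably many codes; one function of $C_0(A)$ chosen for each realized code gives a
    dense set. *)
Lemma separable_C0 : @second_countable A -> separable_subset (C0 A R).
Proof.
move=> /second_countable_enum[e ebase].
pose S c := C0 A R `&` coded e c.
exists ((fun c => xget 0 (S c)) @` [set c | S c !=set0]); split.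
- exact: sub_countable (card_image_le _ _) (countableP _).
- move=> _ [c [f Sf] <-].
  by have [] := xgetPex 0 (ex_intro _ f Sf : exists f, S c f).
move=> f f0 U /nbhs_ballP[r /= r0 fU].
(* The precision $1/(m+1)<r/2$ compensates the factor 2 in [coded_close]. *)
have /ltr_add_invr[m] : 0 < r / 2 by rewrite divr_gt0.
rewrite add0r ltr_pdivlMr// mulrC => mr.
have [l fl] := coded_exists m ebase f0.
have Sf : S (m, l) f by [].
have [gC gl] := xgetPex 0 (ex_intro _ f Sf : exists f, S (m, l) f).
exists (xget 0 (S (m, l))); split; first by exists (m, l) => //; exists f.
apply: fU; rewrite -ball_normE /=.
by apply: le_lt_trans mr; exact: coded_close fl gl.
Qed.

End separability.

(** * The filter at infinity and its relation to compact sets *)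

Section at_infinity.
Context {R : realType} {A : topologicalType}.
Context (h : exhaustion R A).

Lemma at_infinity_proper : ~ compact [set: A] -> ProperFilter (at_infinity h).
Proof.
move=> A_noncompact; apply: filter_from_proper => r _; apply: contrapT => h_le.
apply: A_noncompact; rewrite (_ : setT = h @^-1` `[0, r]).
  exact: exhaustion_proper.
apply/esym; rewrite -subTset => a _ /=; rewrite in_itv/= exhaustion_ge0/= leNgt.
by apply/negP => ra; apply: h_le; exists a.
Qed.

Lemma exhaustion_cvg : h a @[a --> at_infinity h] --> +oo.
Proof. by apply/cvgryPge => r; exists r => // a /ltW. Qed.

(** Compact sets and sublevel sets of [h] are cofinal in each other: [h] is bounded on a compact
    set, and its sublevel sets are compact by properness. *)
Lemma C0P (g : Cb A R) : C0 A R g <-> g a @[a --> at_infinity h] --> 0.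
Proof.
split=> [g0|/cvgrPdist_lt g0].
  apply/cvgrPdist_lt => e /g0[K Kc gK].
  have /compact_bounded[M [_ hM]] : compact (h @` K).
    apply: continuous_compact Kc; apply: continuous_subspaceT.
    exact: exhaustion_continuous.
  (* The bound on [h] over [K] is only guaranteed for numbers strictly above [M]. *)
  exists (M + 1) => // a /= Ma; rewrite sub0r normrN; apply: gK => Ka.
  have := hM (M + 1); rewrite ltrDl ltr01 => /(_ isT (h a)).
  move=> /(_ (ex_intro2 _ _ a Ka erefl)).
  by rewrite /= leNgt (lt_le_trans Ma)// ler_norm.
move=> e /g0[r _ rg]; exists (h @^-1` `[0, r]); first exact: exhaustion_proper.
move=> a /= har; have /rg /= : r < h a.
  by rewrite ltNge; apply/negP => ar; apply: har; rewrite in_itv/= exhaustion_ge0.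
by rewrite sub0r normrN.
Qed.

End at_infinity.

(** * The weight, the weighted limsup and the quotient norm *)

Section weighted.
Context {R : realType} {A : topologicalType}.
Context (h : exhaustion R A) (phi : comparison R).
Local Notation W := (weight h phi).

Lemma weight_gt0 a : 0 < W a.
Proof. exact: lt_le_trans (weight_ge1 h phi a). Qed.

(** Continuity of [phi] is only given within $[0,\infty)$, so the composition goes through the trace
    filter there, which [h] respects by being nonnegative. *)
Lemma weight_continuous : continuous W.
Proof.
move=> a; have [_ /subspace_continuousP phic _ _ _] := comparison_admissible phi.
have h0 b : `[0, +oo[%classic (h b) by rewrite /= in_itv/= andbT exhaustion_ge0.
apply: (@cvg_comp _ _ _ h phi (nbhs a) (within `[0, +oo[ (nbhs (h a)))).
  move=> U /= /(@exhaustion_continuous _ _ h a).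
  by apply: (@filterS _ (nbhs a)) => b /(_ (h0 b)).
exact: phic.
Qed.

(** The suprema over the tails [r < h a] decrease in [r], so their limit is an infimum. *)
Lemma flimsupE (f : A -> R) c : flimsup h phi f c =
  ereal_inf (range (fun r => ereal_sup
    [set weighted_dev h phi f c a | a in [set a | r < h a]])).
Proof.
apply: cvg_lim => //; apply: nonincreasing_cvge => r s rs.
apply: ereal_sup_le => _ [a /= sa <-]; exists a => //=.
exact: le_lt_trans sa.
Qed.

Lemma flimsup_lt (f : A -> R) c M : (flimsup h phi f c < M%:E)%E ->
  \forall a \near at_infinity h, W a * `|f a - c| <= M.
Proof.
rewrite flimsupE => /ereal_inf_lt[_ [r _ <-]] /ltW supM; exists r => // a ra.
by rewrite -lee_fin (le_trans _ supM)//; apply: ereal_sup_ubound; exists a.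
Qed.

Lemma flimsup_le (f : A -> R) c M :
  (\forall a \near at_infinity h, W a * `|f a - c| <= M) ->
  (flimsup h phi f c <= M%:E)%E.
Proof.
move=> [r _ rM]; rewrite flimsupE; apply: ge_ereal_inf; exists (ereal_sup
    [set weighted_dev h phi f c a | a in [set a | r < h a]]); first by exists r.
by apply: ge_ereal_sup => _ [a ra <-]; rewrite lee_fin; exact: rM.
Qed.

(** By noncompactness no tail is empty, which rules out the supremum $-\infty$. *)
Lemma flimsup_ge0 (f : A -> R) c : ~ compact [set: A] ->
  (0 <= flimsup h phi f c)%E.
Proof.
move=> /(at_infinity_proper h) FF; rewrite flimsupE.
apply: le_ereal_inf_tmp => _ [r _ <-].
have [a ra] : [set a | r < h a] !=set0.
  by apply: (@filter_ex _ (at_infinity h)); exists r.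
apply: le_trans (ereal_sup_ubound _); last by exists a.
by rewrite lee_fin mulr_ge0// ltW ?weight_gt0.
Qed.

Lemma Csharp_norm_lt (x : Csharp h phi) (f : continuousType A R) M :
  class f = x -> `|x| < M -> exists c, forall a, W a * `|f a - c| <= M.
Proof.
rewrite Csharp_normE => fx xM; apply: fsharp_norm_lt; move: xM (valP x).
rewrite /sharp_pred inE/= -fx sharp_normE.
by case: (fsharp_norm h phi f) => [r|//|_ _]; [rewrite lte_fin|exact: ltNyr].
Qed.

Lemma Csharp_norm_le (x : Csharp h phi) (f : continuousType A R) M :
  class f = x -> 0 <= M ->
  (forall a, W a * `|f a - lim (f a @[a --> at_infinity h])| <= M) -> `|x| <= M.
Proof.
rewrite Csharp_normE => <- M0 fM.
have : (fsharp_norm h phi f <= M%:E)%E.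
  by apply: fsharp_norm_le; eexists; exact: fM.
rewrite sharp_normE.
(* [fine] sends infinite values to 0, where [0 <= M] concludes. *)
by case: (fsharp_norm h phi f) => [r|//|_ //]; rewrite lee_fin.
Qed.

End weighted.

(** * The map [weighting], which is the isometry $T$ *)

Section weighting_isometry.
Context {R : realType} {A : topologicalType}.
Context (A_noncompact : ~ compact [set: A]).
Context (h : exhaustion R A) (phi : comparison R).
Context (phi_unbounded : phi t @[t --> +oo] --> +oo).
Local Notation W := (weight h phi).
Local Notation limh f := (lim (f a @[a --> at_infinity h])).
Implicit Types (x : Csharp h phi) (f : continuousType A R).

Let at_infinityPF : ProperFilter (at_infinity h).
Proof. exact: at_infinity_proper. Qed.
#[local] Existing Instance at_infinityPF.

Lemma weight_cvg : W a @[a --> at_infinity h] --> +oo.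
Proof.
exact: (@cvg_comp _ _ _ h phi _ _ _ (@exhaustion_cvg _ _ h) phi_unbounded). Qed.

Lemma bounded_dev_cvg (f : A -> R) c M :
  (\forall a \near at_infinity h, W a * `|f a - c| <= M) ->
  f a @[a --> at_infinity h] --> c.
Proof.
move=> fM; apply/cvgrPdist_lt => e e0.
(* Once $We\ge M+1$, a deviation $|f-c|\ge e$ would give $W|f-c|\ge M+1$, against the bound [M]. *)
have /cvgryPge /(_ ((M + 1) / e)) := weight_cvg.
apply: filterS2 fM => a aM; rewrite ler_pdivrMr// => We.
have W0 := weight_gt0 h phi a; rewrite distrC ltNge; apply/negP => ef.
have := ler_wpM2l (ltW W0) ef; lra.
Qed.

Lemma Csharp_cvg x f : class f = x -> cvg (f a @[a --> at_infinity h]).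
Proof.
move=> /Csharp_norm_lt /(_ (ltr_pwDr ltr01 (lexx _)))[c fc].
apply: (@cvgP _ _ c); apply: bounded_dev_cvg; exact: nearW fc.
Qed.

(** A near-optimal constant [c] exists for every [e], and bounded deviation forces each of them to
    be the limit; hence the infimum is attained there. *)
Lemma Csharp_dev_le x f a : class f = x -> W a * `|f a - limh f| <= `|x|.
Proof.
move=> fx; apply/ler_addgt0Pr => e e0.
have [c fc] := Csharp_norm_lt fx (ltr_pwDr e0 (lexx _)).
rewrite (_ : limh f = c)//; apply: cvg_lim => //.
by apply: bounded_dev_cvg; exact: nearW fc.
Qed.

Lemma weighting_subproof x :
  let f := repr (x : Cmod A R) in
  {g : Cb A R | g = (fun a => W a * (f a - limh f)) :> (A -> R)}.
Proof.
apply: Cb_of.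
  move=> a; apply: cvgM; first exact: weight_continuous.
  by apply: cvgB; [exact: cts_fun|exact: cvg_cst].
exists `|x| => a; rewrite normrM gtr0_norm ?weight_gt0//.
by apply: Csharp_dev_le; exact: classP.
Qed.

Definition weighting x : Cb A R := sval (weighting_subproof x).

(** Two representatives differ by a constant, which shifts the limit equally and cancels; this is
    the independence of $T$ from the representative. *)
Lemma weightingE x f a : class f = x -> weighting x a = W a * (f a - limh f).
Proof.
move=> fx; rewrite /weighting; case: weighting_subproof => g /= ->.
set g' := repr (x : Cmod A R).
have /eq_classP[c fc] : class f = class g' by rewrite classP.
have /(@cvg_lim _ (@norm_hausdorff _ _)) -> :
    f a @[a --> at_infinity h] --> limh g' + c.
  rewrite (_ : (f : A -> R) = (fun a => g' a + c)); last exact/funext.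
  by apply: cvgD; [exact: (Csharp_cvg (classP _))|exact: cvg_cst].
by rewrite fc opprD addrACA subrr addr0.
Qed.

Lemma weighting_linear : linear weighting.
Proof.
move=> k x y; apply: val_inj; apply/continuousEP => a.
pose f := repr (x : Cmod A R); pose g := repr (y : Cmod A R).
have fx : class f = x := classP _; have gy : class g = y := classP _.
have fgxy : class (k *: f + g) = k *: x + y :> Cmod A R.
  by rewrite classD classZ fx gy.
rewrite [LHS](weightingE _ fgxy) -[RHS]/(k * weighting x a + weighting y a).
rewrite (weightingE _ fx) (weightingE _ gy).
have /(@cvg_lim _ (@norm_hausdorff _ _)) -> :
    (k *: f + g) a @[a --> at_infinity h] --> k * limh f + limh g.
  apply: cvgD; last exact: Csharp_cvg gy.
  by apply: cvgM; [exact: cvg_cst|exact: Csharp_cvg fx].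
by rewrite -[(k *: f + g) a]/(k * f a + g a); ring.
Qed.

HB.instance Definition _ :=
  GRing.isLinear.Build R (Csharp h phi) (Cb A R) *:%R weighting
    weighting_linear.

Lemma weighting_isometry x : `|weighting x| = `|x|.
Proof.
have fx := classP (x : Cmod A R); apply/eqP; rewrite eq_le; apply/andP; split.
  apply: Cb_norm_le => // a.
  by rewrite (weightingE _ fx) normrM gtr0_norm ?weight_gt0// Csharp_dev_le.
apply: (Csharp_norm_le fx) => // a.
have := Cb_norm_ub (weighting x) a.
by rewrite (weightingE _ fx) normrM gtr0_norm ?weight_gt0.
Qed.

Lemma weighting_surj (g : Cb A R) : exists x, weighting x = g.
Proof.
pose f a := g a / W a.
have fcts : continuous f.
  move=> a; apply: cvgM; first exact: cts_fun.
  by apply: cvgV; [exact/lt0r_neq0/weight_gt0|exact: weight_continuous].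
have Wf a : W a * f a = g a by rewrite mulrC divfK// lt0r_neq0 ?weight_gt0.
have fM a : W a * `|f a - 0| <= `|g|.
  by rewrite subr0 -[W a]gtr0_norm ?weight_gt0// -normrM Wf Cb_norm_ub.
pose c := ctsfun_Sub (mem_set fcts : f \in ctsfun).
have cP : class c \in sharp_pred h phi.
  rewrite inE /= sharp_normE (@le_lt_trans _ _ `|g|%:E) ?ltry//.
  by apply: fsharp_norm_le; exists 0.
(* The deviation of [g / W] from 0 is bounded by the norm of [g], so its limit is 0 and nothing is
   subtracted. *)
exists (MkCsharp cP); apply: val_inj; apply/continuousEP => a.
rewrite [LHS](@weightingE _ c)// (_ : limh c = 0) ?subr0 ?Wf//.
by apply: cvg_lim => //; apply: bounded_dev_cvg; exact: nearW fM.
Qed.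

Lemma decay_classP x : decay_class h phi x <-> C0 A R (weighting x).
Proof.
have fx := classP (x : Cmod A R); set f := repr (x : Cmod A R) in fx.
have wE a : `|weighting x a| = W a * `|f a - limh f|.
  by rewrite (weightingE _ fx) normrM gtr0_norm ?weight_gt0.
rewrite (C0P h) /decay_class /= -fx decay_constE; split=> [fc0|/cvgrPdist_le w0].
  apply/cvgrPdist_le => e e0.
  (* Some constant has limsup below [e]; finiteness already identifies it with the limit, so one
     constant works for all [e]. *)
  have : (fdecay_const h phi f < e%:E)%E by rewrite fc0 lte_fin.
  move=> /ereal_inf_lt[_ [c _ <-]] /flimsup_lt fM.
  have fc : limh f = c by apply: cvg_lim => //; exact: bounded_dev_cvg fM.
  by apply: filterS fM => a; rewrite sub0r normrN wE fc.
apply/eqP; rewrite eq_le; apply/andP; split.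
  apply/lee_addgt0Pr => e e0; rewrite add0e; apply: ge_ereal_inf.
  exists (flimsup h phi f (limh f)); first by exists (limh f).
  apply: flimsup_le; apply: filterS (w0 e e0) => a.
  by rewrite sub0r normrN wE.
by apply: le_ereal_inf_tmp => _ [c _ <-]; exact: flimsup_ge0.
Qed.

Lemma image_decay_class : weighting @` decay_class h phi = C0 A R.
Proof.
apply/seteqP; split=> [_ [x /decay_classP ? <-]//|g g0].
by have [x xg] := weighting_surj g; exists x => //; apply/decay_classP; rewrite xg.
Qed.

End weighting_isometry.

Theorem corollary4p7 (R : realType) (A : topologicalType)
    (A_hausdorff : hausdorff_space A)
    (A_locally_compact : locally_compact [set: A])
    (A_sigma_compact : sigma_compact A)
    (A_noncompact : ~ compact [set: A])
    (h : exhaustion R A) (phi : comparison R)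
    (phi_unbounded : phi t @[t --> +oo] --> +oo) :
  (exists T : {linear Csharp h phi -> Cb A R},
    [/\ forall (x : Csharp h phi) (f : continuousType A R),
          class f = x :> Cmod A R ->
          cvg (f a @[a --> at_infinity h]) /\
          forall a, T x a =
            weight h phi a * (f a - lim (f a @[a --> at_infinity h])),
        forall x, `|T x| = `|x|,
        forall g, exists x, T x = g &
        T @` decay_class h phi = C0 A R]) /\
  [/\ banach_subspace [set: Csharp h phi],
      banach_subspace (decay_class h phi),
      separable_subset (C0 A R) ->
        separable_subset (decay_class h phi) &
      @second_countable A -> separable_subset (C0 A R) /\
        separable_subset (decay_class h phi)].
Proof.
pose T := weighting A_noncompact phi_unbounded : {linear Csharp h phi -> Cb A R}.
have T_iso : forall x, `|T x| = `|x| := weighting_isometry _ _.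
have T_surj : forall g, exists x, T x = g := weighting_surj _ _ _.
have T_decay : T @` decay_class h phi = C0 A R := image_decay_class _ _ _.
have sep : separable_subset (C0 A R) -> separable_subset (decay_class h phi).
  by rewrite -T_decay; exact: separable_subset_isometry.
split.
  exists T; split=> // x f fx; split; first exact: Csharp_cvg fx.
  by move=> a; exact: weightingE.
split=> //.
- apply: (banach_subspace_isometry T_iso); rewrite (_ : _ @` _ = setT).
    exact: banach_Cb.
  by rewrite -subTset => g _; have [x <-] := T_surj g; exists x.
- by apply: (banach_subspace_isometry T_iso); rewrite T_decay; exact: banach_C0.
- by move=> /(separable_C0 (R := R)) sC0; split=> //; exact: sep.
Qed.
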